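(* The vector lattice $V_{\omega_1}=\bigoplus_{1\leqslant\alpha<\omega_1}V_\alpha$, with coordinatewise order, where the vector lattices $V_\alpha$ are those defined in the context, has almost Archimedeanization type $\lambda_{V_{\omega_1}}=\omega_1$.
   Context: All vector spaces are real, $\mathbb N=\{1,2,\dots\}$, and $\omega_1$ is the first uncountable ordinal. A pre-ordered vector space (POVS) is a vector space $X$ with a wedge $X_+$ (non-empty, closed under addition and under multiplication by scalars $t\ge0$); $x\le y$ iff $y-x\in X_+$. An order ideal of $X$ is a vector subspace $A$ such that $a\le x\le b$ with $a,b\in A$ implies $x\in A$; then $X/A$ is pre-ordered by the wedge $[X_+]=\{[x]:x\in X_+\}$. Infinitesimals: $N_X=\{x\in X:\exists\,\xi\in X_+\ \forall n\in\mathbb N\ \ \pm nx+\xi\in X_+\}$. Put $N_0(X)=\{0\}$ and, for every ordinal $\lambda>0$, with $M_\lambda=\bigcup_{\gamma<\lambda}N_\gamma(X)$, put $N_\lambda(X)=\{x\in X:[x]\in N_{X/M_\lambda}\}$ (all $N_\lambda(X)$ and $M_\lambda$ are order ideals of $X$). The almost Archimedeanization type $\lambda_X$ of $X$ is the first ordinal $\lambda$ such that $N_{\lambda+1}(X)=N_\lambda(X)$. Construction. For each countable limit ordinal $\alpha$ fix a strictly increasing cofinal sequence $A_\alpha:\mathbb N\to\alpha$ with values $\ge1$. For $1<\alpha<\omega_1$ and $n\in\mathbb N$ let $\alpha(n)=\beta$ if $\alpha=\beta+1$, and $\alpha(n)=A_\alpha(n)$ if $\alpha$ is a limit ordinal.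 Let $\mathcal P$ be the space of real polynomials in one variable. Define recursively $S_1=\mathbb R$, $1_1=1$, and for $1<\alpha<\omega_1$ $$1_\alpha=(1_{\alpha(n)})_{n\in\mathbb N},\qquad S_\alpha=\mathcal P1_\alpha+\bigoplus_{n\in\mathbb N}S_{\alpha(n)}\subset\prod_{n\in\mathbb N}S_{\alpha(n)},$$ where $p1_\alpha=(p(n)1_{\alpha(n)})_{n\in\mathbb N}$ for $p\in\mathcal P$. Let $I_1$ be a one-point set and $I_\alpha=\coprod_{n\in\mathbb N}I_{\alpha(n)}$ for $\alpha>1$; then $S_\alpha$ is identified recursively with a subspace of $\mathbb R^{I_\alpha}$ (with coordinates $x(i)$, $i\in I_\alpha$), ordered pointwise. For $1\leqslant\beta<\omega_1$ define subspaces $H_\alpha^\beta\subseteq S_\alpha$ recursively by $H_\alpha^\beta=\bigoplus_{n\in\mathbb N}H_{\alpha(n)}^\beta$ if $\beta<\alpha$, and $H_\alpha^\beta=S_\alpha$ if $\beta\geqslant\alpha$. (So $H_\alpha^1=c_{00}(I_\alpha)$ and $H_\alpha^\alpha=S_\alpha$.) Let $V_\alpha=H_\alpha^1\times H_\alpha^\alpha$ with the pointwise lexicographic order $$0\leqslant(x,y)\iff\text{for all }i\in I_\alpha:\ 0<x(i)\ \text{ or }\ (0=x(i)\text{ and }0\leqslant y(i)).$$ The order on the direct sum $\bigoplus_{1\leqslant\alpha<\omega_1}V_\alpha$ is coordinatewise: $0\leqslant(v_\alpha)_\alpha$ iff $0\leqslant v_\alpha$ in $V_\alpha$ for every $\alpha$.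 *)

(* Defs.v *)
From HB Require Import structures.
From mathcomp Require Import all_boot all_order all_algebra.
From mathcomp Require Import generic_quotient.
From mathcomp Require Import all_classical reals.
From mathcomp Require wochoice.

Set Implicit Arguments.
Unset Strict Implicit.
Unset Printing Implicit Defensive.

Import Order.TTheory GRing.Theory Num.Theory.

Local Open Scope classical_set_scope.
Local Open Scope ring_scope.
Local Open Scope quotient_scope.

(* A well-ordered type without maximum, long enough to contain the first
   uncountable ordinal.  Its elements play the role of the ordinals: an element
   a stands for the order type of [set x | x < a].  Since all the notions below
   depend on ordinals up to omega_1 + 1 only, it is immaterial how far beyond
   omega_1 the type extends.  See ordinals_exist for an instance. *)
Record ordinals (d : Order.disp_t) := Ordinals {
  ord_type :> orderType d;
  ord_wf : well_founded (fun a b : ord_type => (a < b)%O);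
  ord_nomax : forall a : ord_type, exists b : ord_type, (a < b)%O;
  omega1 : ord_type;
  omega1_uncountable : ~ countable [set a : ord_type | (a < omega1)%O];
  omega1_first : forall b : ord_type, (b < omega1)%O ->
    countable [set a : ord_type | (a < b)%O]
}.
Arguments omega1 {d} o.

Section OrdinalTheory.
Context {d : Order.disp_t} {O : ordinals d}.
Implicit Types (a b c : O) (P : set O).

(* The default omega1 is returned for P empty only, see least_spec. *)
Definition least P : O :=
  xget (omega1 O) [set a | P a /\ forall b, P b -> (a <= b)%O].

Lemma least_spec P : P !=set0 -> P (least P) /\ forall b, P b -> (least P <= b)%O.
Proof.
move=> [x Px]; rewrite /least.
apply: (@xgetPex O _ [set a | P a /\ forall b, P b -> (a <= b)%O]).
elim: (ord_wf x) Px => {}x _ IH Px.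
have [[y [Py yx]]|no] := pselect (exists y, P y /\ (y < x)%O); first exact: IH yx Py.
exists x; split=> // b Pb; rewrite leNgt; apply/negP => bx.
by apply: no; exists b.
Qed.

Lemma least_in P : P !=set0 -> P (least P).
Proof. by move=> /least_spec[]. Qed.

Lemma least_le P b : P b -> (least P <= b)%O.
Proof. by move=> Pb; have [_] := @least_spec P (ex_intro _ b Pb); apply. Qed.

Definition ozero : O := least setT.
Definition osucc a : O := least [set b | (a < b)%O].
Definition oone : O := osucc ozero.

Definition is_limit a := (ozero < a)%O /\ forall b, a <> osucc b.

Lemma ozero_le a : (ozero <= a)%O. Proof. exact: least_le. Qed.

Lemma osucc_gt a : (a < osucc a)%O.
Proof. exact: (@least_in [set b | (a < b)%O] (ord_nomax a)). Qed.

Lemma osucc_le a b : (a < b)%O -> (osucc a <= b)%O.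
Proof. by move=> ab; apply: least_le. Qed.

End OrdinalTheory.
Arguments ozero {d} O.
Arguments oone {d} O.

(* An instance: the lexicographic product bool * (nat -> bool) * nat, where
   nat -> bool carries an arbitrary well-order. *)
Module OrdinalsInstance.
Import wochoice.

Definition bits := nat -> bool.
HB.instance Definition _ := Choice.on bits.

Definition bits_le : rel bits := projT1 (well_ordering_principle bits).

Lemma bits_wo : well_order bits_le.
Proof. exact: projT2 (well_ordering_principle bits). Qed.

Fact bits_total : total bits_le.
Proof.
move=> x y; have [|z [[]]] := bits_wo (A := pred2 x y).
  by exists x; rewrite inE eqxx.
rewrite !inE => /orP[]/eqP -> lb _; apply/orP; [left|right];
  by apply: lb; rewrite !inE eqxx ?orbT.
Qed.

Fact bits_refl : reflexive bits_le.
Proof. by move=> x; have := bits_total x x; rewrite orbb. Qed.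

Fact bits_anti : antisymmetric bits_le.
Proof.
move=> x y /andP[xy yx]; have [|z [_ uz]] := bits_wo (A := pred2 x y).
  by exists x; rewrite inE eqxx.
rewrite -(uz x); [rewrite -(uz y) //|];
  (split; first by rewrite !inE eqxx ?orbT);
  by move=> w; rewrite !inE => /orP[]/eqP ->; rewrite ?bits_refl.
Qed.

Fact bits_trans : transitive bits_le.
Proof.
move=> y x z xy yz.
have [|w [[]]] := bits_wo (A := [pred u | [|| u == x, u == y | u == z]]).
  by exists x; rewrite inE eqxx.
rewrite !inE => /or3P[]/eqP -> lb _.
- by apply: lb; rewrite !inE eqxx !orbT.
- have yx : bits_le y x by apply: lb; rewrite !inE eqxx.
  by rewrite (bits_anti (introT andP (conj xy yx))).
- have zy : bits_le z y by apply: lb; rewrite !inE eqxx orbT.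
  by rewrite -(bits_anti (introT andP (conj yz zy))).
Qed.

Fact bits_display : Order.disp_t. Proof. exact: Order.Disp tt tt. Qed.

HB.instance Definition _ :=
  Order.Le_isPOrder.Build bits_display bits bits_refl bits_anti bits_trans.
HB.instance Definition _ :=
  Order.POrder_isTotal.Build bits_display bits bits_total.

Lemma bits_wf : well_founded (fun a b : bits => (a < b)%O).
Proof.
move=> x; apply: contrapT => nx.
pose N : {pred bits} := fun u => `[< ~ Acc (fun a b : bits => (a < b)%O) u >].
have [|z [[/asboolP nz lb] _]] := bits_wo (A := N).
  by exists x; apply/asboolP.
apply: nz; constructor => y yz.
apply: contrapT => ny; move: yz; rewrite ltNge => /negP; apply.
by apply: lb; apply/asboolP.
Qed.

Lemma lexi_wf d1 d2 (T1 : orderType d1) (T2 : orderType d2) :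
  well_founded (fun a b : T1 => (a < b)%O) ->
  well_founded (fun a b : T2 => (a < b)%O) ->
  well_founded (fun a b : T1 *l T2 => (a < b)%O).
Proof.
move=> wf1 wf2 [x y]; elim: (wf1 x) y => {}x _ IH1 y.
elim: (wf2 y) => {}y _ IH2; constructor => -[u v].
rewrite Order.ProdLexiOrder.ltEprodlexi /=.
move=> /andP[ux /implyP uv]; move: ux; rewrite le_eqVlt => /predU1P[e|].
  by rewrite e in uv *; apply: IH2; apply: uv.
by move=> ux; exact: IH1.
Qed.

Definition carrier := ((bool *l bits) *l nat)%type.
Definition carrier_order : orderType _ := carrier.

Lemma carrier_wf : well_founded (fun a b : carrier_order => (a < b)%O).
Proof.
apply: lexi_wf; first apply: lexi_wf; last 1 first.
- by move=> n; elim/ltn_ind: n => n IH; constructor=> m; rewrite ltEnat; exact: IH.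
- by move=> b; constructor => b' bb'; constructor => b''; case: b b' b'' bb' => [] [] [].
- exact: bits_wf.
Qed.

Lemma carrier_nomax (a : carrier_order) : exists b : carrier_order, (a < b)%O.
Proof.
case: a => x n; exists (x, n.+1).
by rewrite Order.ProdLexiOrder.ltEprodlexi /= lexx /= ltEnat /= leqnn.
Qed.

Lemma bits_uncountable (f : bits -> nat) : ~ injective f.
Proof.
move=> fI.
pose g : bits := fun n => ~~ `[< exists2 x : bits, f x = n & x n >].
have gP : g (f g) <-> ~ g (f g).
  split=> [/asboolPn ng gg|ng]; first by apply: ng; exists g.
  by apply/asboolPn => -[x /fI ->].
by case: (pselect (g (f g))) => gg; [apply: (proj1 gP)|apply/gg/gP].
Qed.

Definition uncountable_below (a : carrier_order) :=
  ~ countable [set b : carrier_order | (b < a)%O].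

Lemma uncountable_below_ex : exists a, uncountable_below a.
Proof.
pose z : bits := fun=> true.
exists (true, z, 0%N) => /countable_injP[f fI].
apply: (@bits_uncountable (fun x => f (false, x, 0%N))) => x y.
have lt w : (((false, w, 0%N) : carrier_order) < (true, z, 0%N))%O.
  by rewrite !Order.ProdLexiOrder.ltEprodlexi.
by move=> /fI; rewrite !inE => /(_ (lt x) (lt y)) [].
Qed.

Lemma first_uncountable : exists2 a, uncountable_below a &
  forall b, (b < a)%O -> countable [set c : carrier_order | (c < b)%O].
Proof.
have [a ua] := uncountable_below_ex.
elim: (carrier_wf a) ua => {}a _ IH ua.
have [[b [ba ub]]|no] := pselect (exists b, (b < a)%O /\ uncountable_below b).
  exact: IH ba ub.
by exists a => // b ba; apply: contrapT => ub; apply: no; exists b.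
Qed.

End OrdinalsInstance.

Lemma ordinals_exist : exists d, inhabited (ordinals d).
Proof.
have [a ua fa] := OrdinalsInstance.first_uncountable.
have O := Ordinals OrdinalsInstance.carrier_wf OrdinalsInstance.carrier_nomax ua fa.
exact: (ex_intro _ _ (inhabits O)).
Qed.

Section Wedge.
Context {R : realType} {X : lmodType R}.

Definition is_wedge (P : set X) :=
  [/\ P !=set0, (forall x y, P x -> P y -> P (x + y)) &
      (forall t x, 0 <= t -> P x -> P (t *: x))].

Definition linear_subspace (A : set X) :=
  A 0 /\ forall t x y, A x -> A y -> A (t *: x + y).

End Wedge.

Record povs (R : realType) := POVS {
  povs_sort :> lmodType R;
  pos : set povs_sort;
  pos_wedge : is_wedge pos
}.
Arguments pos {R} p.

(* The vector space X / A.  To have it defined for every set A, the quotient is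
   taken by the linear span of A, which is A itself when A is a subspace. *)
Section QuotientSpace.
Variables (R : realType) (X : lmodType R) (A : set X).

Definition lspan : set X := smallest linear_subspace A.

Lemma lspan_subspace : linear_subspace lspan.
Proof.
split=> [B [[B0 _] _] //|t x y Ax Ay B [Bs AB]].
by case: (Bs) => _; apply; [apply: Ax|apply: Ay].
Qed.

Lemma lspan_id : linear_subspace A -> lspan = A.
Proof.
move=> As; apply/seteqP; split; first by move=> x xA; apply: (xA A); split.
by move=> x Ax B [_]; apply.
Qed.

Lemma lspanD x y : lspan x -> lspan y -> lspan (x + y).
Proof. by move=> Ax Ay; rewrite -[x]scale1r; apply: (proj2 lspan_subspace). Qed.

Lemma lspanZ t x : lspan x -> lspan (t *: x).
Proof.
move=> Ax; rewrite -[_ *: _]addr0; apply: (proj2 lspan_subspace) => //.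
exact: (proj1 lspan_subspace).
Qed.

Lemma lspanN x : lspan x -> lspan (- x).
Proof. by rewrite -scaleN1r; exact: lspanZ. Qed.

Definition qequiv (x y : X) : bool := `[< lspan (x - y) >].

Lemma qequiv_is_equiv : equiv_class_of qequiv.
Proof.
split=> [x|x y|y x z].
- by apply/asboolP; rewrite subrr; exact: (proj1 lspan_subspace).
- by apply/asboolP/asboolP => /lspanN; rewrite opprB.
- move=> /asboolP xy /asboolP yz; apply/asboolP.
  by have := lspanD xy yz; rewrite addrA subrK.
Qed.

Canonical qequiv_equiv := EquivRelPack qequiv_is_equiv.
Canonical qequiv_encModRel := defaultEncModRel qequiv.

Definition quot_space := {eq_quot qequiv}.
HB.instance Definition _ : EqQuotient X qequiv quot_space :=
  EqQuotient.on quot_space.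
HB.instance Definition _ := Choice.on quot_space.

Definition qproj (x : X) : quot_space := \pi_quot_space x.

Lemma qprojP x y : qproj x = qproj y <-> lspan (x - y).
Proof.
by split=> [/eqP|xy]; [rewrite /qproj eqmodE => /asboolP|
  apply/eqP; rewrite /qproj eqmodE; apply/asboolP].
Qed.

Lemma qprojK (u : quot_space) : qproj (repr u) = u.
Proof. exact: reprK. Qed.

Let qadd (u v : quot_space) := qproj (repr u + repr v).
Let qopp (u : quot_space) := qproj (- repr u).
Let qscale (t : R) (u : quot_space) := qproj (t *: repr u).

Let qrepr x : lspan (repr (qproj x) - x).
Proof. by apply/qprojP; rewrite qprojK. Qed.

Let qaddE x y : qadd (qproj x) (qproj y) = qproj (x + y).
Proof. by apply/qprojP; rewrite opprD addrACA; apply: lspanD; exact: qrepr. Qed.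

Let qoppE x : qopp (qproj x) = qproj (- x).
Proof. by apply/qprojP; rewrite -opprD; apply: lspanN; exact: qrepr. Qed.

Let qscaleE t x : qscale t (qproj x) = qproj (t *: x).
Proof. by apply/qprojP; rewrite -scalerBr; apply: lspanZ; exact: qrepr. Qed.

Let qaddA : associative qadd.
Proof.
by move=> u v w; rewrite -[u]qprojK -[v]qprojK -[w]qprojK !qaddE addrA.
Qed.

Let qaddC : commutative qadd.
Proof. by move=> u v; rewrite /qadd addrC. Qed.

Let qadd0 : left_id (qproj 0) qadd.
Proof. by move=> u; rewrite -[u]qprojK qaddE add0r. Qed.

Let qaddN : left_inverse (qproj 0) qopp qadd.
Proof. by move=> u; rewrite -[u]qprojK qoppE qaddE addNr. Qed.

HB.instance Definition _ :=
  GRing.isZmodule.Build quot_space qaddA qaddC qadd0 qaddN.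

Let qscaleA a b u : qscale a (qscale b u) = qscale (a * b) u.
Proof. by rewrite -[u]qprojK !qscaleE scalerA. Qed.

Let qscale1 : left_id 1 qscale.
Proof. by move=> u; rewrite -[u]qprojK qscaleE scale1r. Qed.

Let qscaleDr : right_distributive qscale +%R.
Proof.
move=> a u v; rewrite -[u]qprojK -[v]qprojK.
by rewrite [X in qscale _ X]qaddE !qscaleE [RHS]qaddE scalerDr.
Qed.

Let qscaleDl u : {morph qscale^~ u : a b / a + b}.
Proof.
by move=> a b; rewrite -[u]qprojK !qscaleE [RHS]qaddE scalerDl.
Qed.

HB.instance Definition _ := GRing.Zmodule_isLmodule.Build R quot_space
  qscaleA qscale1 qscaleDr qscaleDl.

Lemma qprojD x y : qproj (x + y) = qproj x + qproj y.
Proof. by rewrite -[LHS]qaddE. Qed.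

Lemma qprojZ t x : qproj (t *: x) = t *: qproj x.
Proof. by rewrite -[LHS]qscaleE. Qed.

End QuotientSpace.
Arguments qproj {R X} A x.

Section QuotientPOVS.
Variables (R : realType) (X : povs R) (A : set X).

Definition quot_pos : set (quot_space A) := [set qproj A x | x in pos X].

Lemma quot_pos_wedge : is_wedge quot_pos.
Proof.
have [[x0 p0] pD pZ] := pos_wedge X.
split; first by exists (qproj A x0), x0.
- move=> _ _ [x px <-] [y py <-]; exists (x + y); first exact: pD.
  exact: qprojD.
- move=> t _ t0 [x px <-]; exists (t *: x); first exact: pZ.
  exact: qprojZ.
Qed.

Definition quot_povs : povs R := POVS quot_pos_wedge.

End QuotientPOVS.

Definition infinitesimals (R : realType) (X : povs R) : set X :=
  [set x | exists2 xi, pos X xi &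
     forall n : nat, (0 < n)%N -> pos X (x *+ n + xi) /\ pos X (- (x *+ n) + xi)].
Arguments infinitesimals {R} X.

Section AlmostArchimedeanization.
Context {R : realType} {d : Order.disp_t} {O : ordinals d}.
Variable X : povs R.

Definition Nstep (l : O) (rec : forall g : O, (g < l)%O -> set X) : set X :=
  if l == ozero O then [set 0]
  else let M : set X := [set x | exists g (gl : (g < l)%O), rec g gl x] in
       [set x | infinitesimals (quot_povs M) (qproj M x)].

Definition Nideal : O -> set X := Fix (@ord_wf d O) (fun=> set X) Nstep.

Definition Mideal (l : O) : set X :=
  [set x | exists2 g : O, (g < l)%O & Nideal g x].

Lemma NidealE (l : O) : Nideal l =
  if l == ozero O then [set 0]
  else [set x | infinitesimals (quot_povs (Mideal l)) (qproj (Mideal l) x)].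
Proof.
rewrite /Nideal Fix_eq /Nstep => [|a f g fg]; last first.
  by congr Nstep; apply: functional_extensionality_dep => b;
     apply: functional_extensionality_dep.
case: ifP => // _; rewrite -/Nideal /=.
suff -> : [set x | exists g (_ : (g < l)%O), Nideal g x] = Mideal l by [].
by apply/seteqP; split=> x [g [gl Ng]]; exists g.
Qed.

(* lambda_X = l, the first l with N_(l+1) = N_l *)
Definition almost_archimedeanization_type (l : O) :=
  Nideal (osucc l) = Nideal l /\
  forall g : O, Nideal (osucc g) = Nideal g -> (l <= g)%O.

End AlmostArchimedeanization.
Arguments Nideal {R d O} X l.
Arguments Mideal {R d O} X l.

Definition is_vector_lattice (R : realType) (X : povs R) :=
  (forall x : X, pos X x -> pos X (- x) -> x = 0) /\
  forall x y : X, exists z : X,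
    [/\ pos X (z - x), pos X (z - y) &
        forall w : X, pos X (w - x) -> pos X (w - y) -> pos X (w - z)].

(* Sequences are indexed by k : nat, which stands for n = k + 1. *)
Record cofinal_sequences (d : Order.disp_t) (O : ordinals d) :=
  CofinalSequences {
  cofseq :> O -> nat -> O;
  cofseq_range : forall a, (a < omega1 O)%O -> is_limit a ->
    forall k, (oone O <= cofseq a k < a)%O;
  cofseq_strict : forall a, (a < omega1 O)%O -> is_limit a ->
    forall k l, (k < l)%N -> (cofseq a k < cofseq a l)%O;
  cofseq_cofinal : forall a, (a < omega1 O)%O -> is_limit a ->
    forall b, (b < a)%O -> exists k, (b <= cofseq a k)%O
}.

Section Construction.
Variable R : realType.
Context {d : Order.disp_t} {O : ordinals d}.
Variable A : cofinal_sequences O.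

(* alpha(n): the predecessor of alpha if there is one, A_alpha(n) otherwise *)
Definition fund (a : O) (k : nat) : O := xget (A a k) [set b | a = osucc b].

Definition index_range (a : O) := (oone O <= a < omega1 O)%O.

Definition step_range (a : O) := (oone O < a < omega1 O)%O.

(* A coproduct of sets of words is formed by prefixing the words of the k-th
   summand with the letter k; thus I_alpha consists of the words k1 :: ... :: kr
   such that alpha(k1)...(kr) = 1. *)
Inductive I_ : O -> set (seq nat) :=
| I_one : I_ (oone O) [::]
| I_step a k i : step_range a -> I_ (fund a k) i -> I_ a (k :: i).

(* R^(I_alpha) is the space of the functions vanishing outside I_alpha. *)
Local Notation F := (seq nat -> R^o)%type.

(* the family (s_k)_k in the product of the R^(I_alpha(k)), as an element of
   R^(I_alpha) *)
Definition glue (s : nat -> F) : F :=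
  fun i => if i is k :: j then s k j else 0.

(* 1_alpha; ones_one and ones_step are its recursive definition *)
Definition ones (a : O) : F := fun i => (i \in I_ a)%:R.

Definition poly_ones (p : {poly R}) (a : O) : F :=
  glue (fun k => p.[k.+1%:R] *: ones (fund a k)).

Definition finitely_supported (T : Type) (M : zmodType) (s : T -> M) :=
  finite_set [set t | s t <> 0].

Inductive S_ : O -> set F :=
| S_one (c : R) : S_ (oone O) (c *: ones (oone O))
| S_step a (p : {poly R}) (s : nat -> F) : step_range a ->
    (forall k, S_ (fund a k) (s k)) -> finitely_supported s ->
    S_ a (poly_ones p a + glue s).

Inductive H_ (b : O) : O -> set F :=
| H_full a x : (a <= b)%O -> S_ a x -> H_ b a x
| H_sum a (s : nat -> F) : step_range a -> (b < a)%O ->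
    (forall k, H_ b (fund a k) (s k)) -> finitely_supported s ->
    H_ b a (glue s).

Definition V_ (a : O) : set (F * F)%type :=
  [set v | H_ (oone O) a v.1 /\ H_ a a v.2].

Definition V_pos (a : O) (v : (F * F)%type) :=
  forall i, I_ a i -> 0 < v.1 i \/ (0 = v.1 i /\ 0 <= v.2 i).

Lemma osucc_lt (a b : O) : (a < b)%O -> (osucc a < osucc b)%O.
Proof. by move=> ab; apply: le_lt_trans (osucc_le ab) (osucc_gt b). Qed.

Lemma fund_succ a b k : a = osucc b -> fund a k = b.
Proof.
move=> ->; rewrite /fund; case: xgetP => [c _ /= bc|/(_ b) []//].
by case: (ltgtP b c) => // /osucc_lt; rewrite bc ltxx.
Qed.

Lemma fund_limit a k : is_limit a -> fund a k = A a k.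
Proof. by case=> _ nsucc; rewrite /fund; case: xgetP => // b _ /nsucc. Qed.

Lemma fund_range a k : step_range a -> (oone O <= fund a k < a)%O.
Proof.
move=> /andP[a1 aw].
have [[b ab]|nsucc] := pselect (exists b, a = osucc b).
  rewrite (fund_succ _ ab) ab osucc_gt andbT leNgt; apply/negP => /osucc_le.
  by rewrite -ab leNgt a1.
have la : is_limit a.
  split; last by move=> b ab; apply: nsucc; exists b.
  exact: lt_trans (osucc_gt _) a1.
by rewrite fund_limit //; apply: cofseq_range.
Qed.

Lemma step_range1 : ~ step_range (oone O).
Proof. by rewrite /step_range ltxx. Qed.

Lemma ones_one : ones (oone O) = (fun i => (i == [::])%:R).
Proof.
apply/funext => i; rewrite /ones; congr (nat_of_bool _)%:R.
apply/idP/eqP => [|->]; last by rewrite inE; exact: I_one.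
by rewrite inE => Ii; inversion Ii => //; case: step_range1.
Qed.

Lemma ones_step a : step_range a -> ones a = glue (fun k => ones (fund a k)).
Proof.
move=> ar; apply/funext => -[|k i]; rewrite /ones /glue.
  rewrite [_ \in _](_ : _ = false)//; apply/negbTE; rewrite notin_setE => Ia.
  by inversion Ia as [a1|]; case: step_range1; rewrite a1.
congr (nat_of_bool _)%:R; apply/idP/idP; rewrite !inE => Ii; last exact: I_step.
by inversion Ii.
Qed.

Lemma index_ind (P : O -> Prop) : P (oone O) ->
  (forall a, step_range a -> (forall k, P (fund a k)) -> P a) ->
  forall a, index_range a -> P a.
Proof.
move=> P1 Pstep a; elim: (ord_wf a) => {}a _ IH /andP[].
rewrite le_eqVlt => /predU1P[<- //|a1 aw].
have ar : step_range a by apply/andP.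
apply: Pstep => // k; have /andP[f1 fa] := fund_range k ar.
by apply: IH => //; apply/andP; split=> //; exact: lt_trans fa aw.
Qed.

Lemma glue0 : glue 0 = 0.
Proof. by apply/funext => -[]. Qed.

Lemma glue_lin t s s' : glue (t *: s + s') = t *: glue s + glue s'.
Proof.
apply/funext => -[|k i]; rewrite /glue /=; last by [].
by rewrite [RHS]addr0; rewrite [RHS]scaler0.
Qed.

Lemma poly_ones_lin t p q a :
  poly_ones (t *: p + q) a = t *: poly_ones p a + poly_ones q a.
Proof.
rewrite /poly_ones -glue_lin; congr glue; apply/funext => k.
by rewrite hornerD hornerZ scalerDl -scalerA.
Qed.

Lemma poly_ones0 a : poly_ones 0 a = 0.
Proof.
rewrite -glue0 /poly_ones; congr glue; apply/funext => k.
by rewrite horner0 scale0r.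
Qed.

Lemma finitely_supported0 (T : Type) (M : zmodType) :
  finitely_supported (0 : T -> M).
Proof.
rewrite /finitely_supported (_ : [set _ | _] = set0) //.
by apply/seteqP; split=> t //=.
Qed.

Lemma finitely_supported_lin (T : Type) (M : lmodType R) t (s s' : T -> M) :
  finitely_supported s -> finitely_supported s' ->
  finitely_supported (t *: s + s').
Proof.
move=> fs fs'.
have fU : finite_set ([set x | s x <> 0] `|` [set x | s' x <> 0]).
  by rewrite finite_setU.
apply: sub_finite_set fU => x /= tss'.
have [sx|sx] := pselect (s x = 0); [right|by left] => s'x; apply: tss'.
by rewrite /= [LHS](_ : _ = t *: s x + s' x) // sx s'x scaler0 addr0.
Qed.

Lemma S_one0 : S_ (oone O) 0.
Proof. by rewrite (_ : 0 = 0 *: ones (oone O)); [exact: S_one|rewrite scale0r]. Qed.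

Lemma S_0 a : index_range a -> S_ a 0.
Proof.
move: a; apply: index_ind => [|a ar IH]; first exact: S_one0.
have := S_step 0 ar IH (finitely_supported0 _ _).
by rewrite poly_ones0 glue0 addr0.
Qed.

Lemma S_lin a t x y : S_ a x -> S_ a y -> S_ a (t *: x + y).
Proof.
move=> Sx; elim: Sx y => {a x} [c y Sy|a p s ar Ss IH fs y Sy].
  inversion Sy as [e|]; last by case: step_range1.
  by rewrite scalerA -scalerDl; exact: S_one.
inversion Sy as [e a1|b q u br Su fu ba]; first by case: step_range1; rewrite a1.
rewrite scalerDr addrACA -poly_ones_lin -glue_lin; apply: S_step => //.
  by move=> k; exact: IH.
exact: finitely_supported_lin.
Qed.

Lemma H_0 b a : (oone O <= b)%O -> index_range a -> H_ b a 0.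
Proof.
move=> b1; move: a; apply: index_ind => [|a ar IH].
  by apply: H_full => //; exact: S_one0.
have [ab|ba] := leP a b.
  apply: H_full => //; apply: S_0; have /andP[a1 aw] := ar.
  by apply/andP; split=> //; exact: ltW.
by rewrite -glue0; apply: H_sum => //; exact: finitely_supported0.
Qed.

Lemma H_lin b a t x y : H_ b a x -> H_ b a y -> H_ b a (t *: x + y).
Proof.
move=> Hx; elim: Hx y => {a x} [a x ab Sx y Hy|a s ar ba Hs IH fs y Hy].
  inversion Hy as [a' y' ? Sy|a' u ? ba]; last by move: ba; rewrite ltNge ab.
  by apply: H_full => //; exact: S_lin.
inversion Hy as [a' y' ab|a' u ? ? Hu fu]; first by move: ba; rewrite ltNge ab.
rewrite -glue_lin; apply: H_sum => //.
  by move=> k; exact: IH.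
exact: finitely_supported_lin.
Qed.

(* V_(omega_1), as a subspace of the space of all functions on the ordinals with
   values in R^(seq nat) * R^(seq nat) *)
Definition V_omega1_set : set (O -> (F * F)%type) :=
  [set v | [/\ finitely_supported v,
               forall a, ~ index_range a -> v a = 0 &
               forall a, index_range a -> V_ a (v a)]].

Definition V_omega1_pred : {pred O -> (F * F)%type} := mem V_omega1_set.

Lemma V_omega1_submod : submod_closed V_omega1_pred.
Proof.
split=> [|t v w].
  rewrite inE; split=> [|//|a ar]; first exact: finitely_supported0.
  by split; apply: H_0 => //; case/andP: ar.
rewrite !inE => -[fv v0 Vv] [fw w0 Vw]; split=> [|a ar|a ar].
- exact: finitely_supported_lin.
- by rewrite [LHS](_ : _ = t *: v a + w a) // v0 // w0 // scaler0 addr0.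
- by split; apply: H_lin; have [] := Vv _ ar; have [] := Vw _ ar.
Qed.

HB.instance Definition _ :=
  GRing.isSubmodClosed.Build R (O -> (F * F)%type) V_omega1_pred V_omega1_submod.

Record V_omega1_space := VOmega1 {
  V_omega1_val :> O -> (F * F)%type;
  V_omega1_valP : V_omega1_val \in V_omega1_pred
}.

HB.instance Definition _ := [isSub for V_omega1_val].
HB.instance Definition _ := [Choice of V_omega1_space by <:].
HB.instance Definition _ := [SubChoice_isSubLmodule of V_omega1_space by <:].

Definition V_omega1_pos : set V_omega1_space :=
  [set v | forall a, index_range a -> V_pos a (v a)].

Lemma V_omega1_pos_wedge : is_wedge V_omega1_pos.
Proof.
split.
- by exists 0 => a ar i Ii; right.
- move=> v w pv pw a ar i Ii.
  have -> : ((v + w) a).1 i = (v a).1 i + (w a).1 i by [].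
  have -> : ((v + w) a).2 i = (v a).2 i + (w a).2 i by [].
  case: (pv a ar i Ii) (pw a ar i Ii) => [vi|[<- vi2]] [wi|[<- wi2]].
  + by left; apply: addr_gt0.
  + by left; rewrite addr0.
  + by left; rewrite add0r.
  + by right; split; [rewrite addr0|apply: addr_ge0].
- move=> t v t0 pv a ar i Ii.
  have -> : ((t *: v) a).1 i = t * (v a).1 i by [].
  have -> : ((t *: v) a).2 i = t * (v a).2 i by [].
  case: (pv a ar i Ii) => [vi|[<- vi2]]; last first.
    by right; rewrite mulr0; split=> //; apply: mulr_ge0.
  move: t0; rewrite le_eqVlt => /predU1P[<-|t0]; last by left; apply: mulr_gt0.
  by right; rewrite !mul0r.
Qed.

Definition V_omega1 : povs R := POVS V_omega1_pos_wedge.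

End Construction.

(* Main.v *)
Require Import Defs.
From mathcomp Require Import all_boot all_order all_algebra.
From mathcomp Require Import all_classical reals.
From mathcomp Require Import polyrcf lra.

(** Everything is read off the words [i] at which a vector [v] of the direct sum
    is nonzero in its first or its second coordinate.

    First coordinates.  Infinitesimality of [v] modulo [M] bounds all multiples
    of a first coordinate by a fixed number as soon as [M] has no first
    coordinates.  Hence, by induction on [l], no vector of [N_l] has a nonzero
    first coordinate ([Nideal_coord1]).

    Lower bound.  Call [a] the ordinal at the node [w] of the tree of words when
    [a = alpha(w_1)...(w_r)], and graft a function [y] of [S_a] at [w] by letting
    it live on the words with prefix [w].  Every graft [(0, y)] of an element of
    [S_a] is in [N_a] ([inN_single]).  If [a = 1], then [(0, y)] is dominated by
    [(1_1, 0)], which is infinitely larger in the lexicographic order.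
    If [a > 1] and [y = p 1_a + (s_k)_k], then the finitely many [s_k] are grafts
    at children of [w], whose ordinals are below [a], so that they vanish modulo
    [M_a]; and [p 1_a] is dominated by [q 1_a] with [q = X (1 + p^2)], because
    [n |p(k)| <= q(k)] as soon as [k >= n], the smaller [k] being absorbed by
    [M_a] again.  A vector with zero first coordinates is a finite sum of such
    grafts at roots [a < omega_1], hence is in [N_(omega_1)]; so the chain is
    stationary from [omega_1] on.

    Upper bound.  If [v] is in [N_l], then at each node [w] whose ordinal [a]
    exceeds [l] the vector [v] vanishes below almost all children of [w]
    ([Nideal_node]).  Write [v = p 1_a] and a dominating vector [xi = q 1_a]
    below almost all children.  The ordinal [a(k)] of the [k]-th child is at
    least [l] for large [k], hence exceeds every [g < l]; by induction each
    correction from [M_l] vanishes somewhere below that child, so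
    [n |p(k)| <= q(k)] holds with the same [k] for all [n], and [p(k) = 0].
    In particular [(0, 1_(g+1))] in the summand of index [g + 1] is in
    [N_(g+1)] but not in [N_g], for all [g < omega_1].

    Lattice.  The supremum is the pointwise lexicographic maximum.  It stays in
    the space because a real polynomial has eventually constant sign, so [S_a]
    is closed under absolute values ([S_abs]), and because a function that
    vanishes outside the finite supports of given elements of [H_a^1] is in
    [H_a^1] ([H1_solid]). *)

Set Implicit Arguments.
Unset Strict Implicit.
Unset Printing Implicit Defensive.

Import Order.TTheory GRing.Theory Num.Theory.

Local Open Scope classical_set_scope.
Local Open Scope ring_scope.

(* The gluing of functions on classical sets has the same name. *)
Local Notation glue := Defs.glue.

(** * Infinitesimals of a pre-ordered vector space *)

Section Infinitesimals.
Context {R : realType}.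

Lemma pos0 (X : povs R) : pos X 0.
Proof.
by have [[x px] _ pZ] := pos_wedge X; rewrite -[0](scale0r x); apply: pZ.
Qed.

Lemma posD (X : povs R) x y : pos X x -> pos X y -> pos X (x + y).
Proof. by have [_ + _] := pos_wedge X; apply. Qed.

Lemma posZ (X : povs R) t x : 0 <= t -> pos X x -> pos X (t *: x).
Proof. by have [_ _] := pos_wedge X; apply. Qed.

(** [s x + xi] lies on the segment from [xi] to [t x + xi]. *)
Lemma pos_between (X : povs R) (x xi : X) (s t : R) : 0 <= s <= t -> pos X xi ->
  pos X (t *: x + xi) -> pos X (s *: x + xi).
Proof.
move=> /andP[s0 st] pxi ptx.
have [t0|t_gt0] := eqVneq t 0.
  have -> : s = 0 by apply/eqP; rewrite eq_le s0 -t0 st.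
  by rewrite scale0r add0r.
have tp : 0 < t by rewrite lt_def t_gt0 (le_trans s0).
have -> : s *: x + xi = (s / t) *: (t *: x + xi) + (1 - s / t) *: xi.
  by rewrite scalerDr scalerA divfK // -addrA -scalerDl [s / t + _]addrC subrK scale1r.
apply: posD; apply: posZ => //; first by rewrite divr_ge0 // ltW.
by rewrite subr_ge0 ler_pdivrMr // mul1r.
Qed.

(** Real multiples lie between integral ones, so the bound [xi] serves all of
    them; this makes sums and multiples of infinitesimals infinitesimal. *)
Lemma infinitesimals_bound (X : povs R) (x xi : X) : pos X xi ->
  (forall n, (0 < n)%N -> pos X (x *+ n + xi) /\ pos X (- (x *+ n) + xi)) ->
  forall t : R, pos X (t *: x + xi).
Proof.
move=> pxi px t; pose n := (Num.trunc `|t|).+1.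
have tn : `|t| <= n%:R by rewrite ltW // truncnS_gt.
have [p1 p2] := px n isT.
have [t0|t0] := leP 0 t.
  apply: (@pos_between X x xi _ n%:R) => //; first by rewrite t0 -(ger0_norm t0).
  by rewrite scaler_nat.
rewrite -[t]opprK scaleNr -scalerN.
apply: (@pos_between X _ xi _ n%:R) => //; last by rewrite scalerN scaler_nat.
by rewrite oppr_ge0 ltW // -(ltr0_norm t0).
Qed.

Lemma infinitesimals_subspace (X : povs R) :
  linear_subspace (infinitesimals X).
Proof.
split=> [|t x y [xi pxi px] [eta peta py]].
  exists 0; first exact: pos0.
  by move=> n _; rewrite mul0rn oppr0 addr0; split; exact: pos0.
have bdx := infinitesimals_bound pxi px; have bdy := infinitesimals_bound peta py.
exists (xi + eta) => [|n _]; first exact: posD.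
rewrite -scaler_nat -scaleNr !scalerDr !scalerA.
by split; rewrite addrACA; apply: posD.
Qed.
End Infinitesimals.

(** * The chain of ideals [N_l] *)

Section Ideals.
Context {R : realType} {d : Order.disp_t} {O : ordinals d}.
Variable X : povs R.
Implicit Types (l g : O) (x : X).

Lemma qproj0 (A : set X) x : A x -> qproj A x = 0.
Proof.
move=> Ax; rewrite -[0](scale0r (qproj A 0)) -qprojZ; apply/qprojP.
by rewrite scale0r subr0 => B [_]; apply.
Qed.

Lemma qprojMn (A : set X) x n : qproj A (x *+ n) = qproj A x *+ n.
Proof. by rewrite -!scaler_nat qprojZ. Qed.

Lemma qprojN (A : set X) x : qproj A (- x) = - qproj A x.
Proof. by rewrite -!scaleN1r qprojZ. Qed.

Lemma Nideal0 : Nideal X (ozero O) = [set 0].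
Proof. by rewrite NidealE eqxx. Qed.

Lemma Nideal_gt0 l : (ozero O < l)%O ->
  Nideal X l = [set x | infinitesimals (quot_povs (Mideal X l)) (qproj (Mideal X l) x)].
Proof. by move=> l0; rewrite NidealE gt_eqF. Qed.

Lemma ozeroVgt0 l : l = ozero O \/ (ozero O < l)%O.
Proof. by have := ozero_le l; rewrite le_eqVlt => /predU1P[->|]; [left|right]. Qed.

Lemma Nideal_subspace l : linear_subspace (Nideal X l).
Proof.
have [->|l0] := ozeroVgt0 l.
  by rewrite Nideal0; split=> // t x y /= -> ->; rewrite scaler0 addr0.
rewrite Nideal_gt0 //.
have [I0 IL] := infinitesimals_subspace (quot_povs (Mideal X l)).
split=> [|t x y Ix Iy] /=.
  by rewrite -(scale0r (0 : X)) qprojZ scale0r.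
by rewrite qprojD qprojZ; apply: IL.
Qed.

Lemma Mideal_sub l x : Mideal X l x -> Nideal X l x.
Proof.
move=> Mx; have [l0|l0] := ozeroVgt0 l.
  by case: Mx => g; rewrite l0 ltNge ozero_le.
rewrite Nideal_gt0 //= qproj0 //.
by case: (infinitesimals_subspace (quot_povs (Mideal X l))).
Qed.

Lemma Nideal_le g l : (g <= l)%O -> Nideal X g `<=` Nideal X l.
Proof.
by rewrite le_eqVlt => /predU1P[-> //|gl] x Nx; apply: Mideal_sub; exists g.
Qed.

Lemma Mideal_subspace l : (ozero O < l)%O -> linear_subspace (Mideal X l).
Proof.
move=> l0; split=> [|t x y [g gl Nx] [h hl Ny]].
  by exists (ozero O) => //; case: (Nideal_subspace (ozero O)).
exists (Order.max g h); first by rewrite gt_max gl.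
have [_] := Nideal_subspace (Order.max g h); apply.
  by apply: Nideal_le Nx; rewrite le_max lexx.
by apply: Nideal_le Ny; rewrite le_max lexx orbT.
Qed.

(** As [M_l] is a subspace, its linear span adds nothing, and positivity in
    the quotient is positivity after correction by an element of [M_l]. *)
Lemma quot_posP l x : (ozero O < l)%O ->
  pos (quot_povs (Mideal X l)) (qproj (Mideal X l) x) <->
  exists2 m, Mideal X l m & pos X (x + m).
Proof.
move=> l0; have Ms := Mideal_subspace l0; split=> [[u pu /qprojP]|[m Mm px]].
  rewrite lspan_id // => Mux; exists (u - x) => //.
  by rewrite addrC subrK.
exists (x + m) => //.
by rewrite qprojD (qproj0 Mm) addr0.
Qed.

(** The form in which membership in [N_l] is used and proved: the corrections
    [m] may depend on [n] and on the sign, the dominating [xi] may not. *)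
Lemma Nideal_posP l x : (ozero O < l)%O -> Nideal X l x <->
  exists2 xi, pos X xi & forall n, (0 < n)%N ->
    (exists2 m, Mideal X l m & pos X (x *+ n + xi + m)) /\
    (exists2 m, Mideal X l m & pos X (- (x *+ n) + xi + m)).
Proof.
move=> l0; rewrite Nideal_gt0 //; split=> /=.
  move=> [_ [xi pxi <-] px]; exists xi => // n n0; have [] := px n n0.
  rewrite -qprojMn -qprojN -!qprojD.
  by move=> /(quot_posP _ l0) p1 /(quot_posP _ l0) p2.
move=> [xi pxi px]; exists (qproj (Mideal X l) xi); first by exists xi.
move=> n n0; have [] := px n n0.
by rewrite -qprojMn -qprojN -!qprojD => p1 p2; split; apply/(quot_posP _ l0).
Qed.

End Ideals.

(** * Countable ordinals and the tree of words *)

Section Ordinals.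
Context {d : Order.disp_t} {O : ordinals d}.
Variable A : cofinal_sequences O.
Implicit Types a b g : O.

Lemma lt_osucc a b : (a < osucc b)%O -> (a <= b)%O.
Proof.
by move=> ab; rewrite leNgt; apply/negP => /osucc_le; rewrite leNgt ab.
Qed.

Lemma oone_gt0 : (ozero O < oone O)%O.
Proof. exact: osucc_gt. Qed.

Lemma omega1_gt0 : (ozero O < omega1 O)%O.
Proof.
rewrite ltNge; apply/negP => w0; apply: (@omega1_uncountable _ O).
rewrite (_ : [set a | _] = set0); first exact: countable0.
by apply/seteqP; split=> // a /= aw; have := lt_le_trans aw w0; rewrite ltNge ozero_le.
Qed.

(** Otherwise the ordinals below [omega1] would be those below [a] and [a]
    itself, a countable set. *)
Lemma osucc_lt_omega1 a : (a < omega1 O)%O -> (osucc a < omega1 O)%O.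
Proof.
move=> aw; rewrite lt_neqAle osucc_le // andbT; apply/eqP => sw.
apply: (@omega1_uncountable _ O); rewrite -sw.
rewrite (_ : [set b | _] =
    \bigcup_(e in [set: bool]) if e then [set b | (b < a)%O] else [set a]).
  by apply: bigcup_countable => // -[] _; [exact: omega1_first|exact: countable1].
apply/seteqP; split=> b /=.
  move/lt_osucc; rewrite le_eqVlt => /predU1P[ba|ba]; first by exists false.
  by exists true.
by case=> -[] _ /= => [ba|->]; [exact: lt_trans ba (osucc_gt _)|exact: osucc_gt].
Qed.

Lemma oone_index : index_range (oone O).
Proof. by apply/andP; split=> //; exact: osucc_lt_omega1 omega1_gt0. Qed.

Lemma index_gt0 a : index_range a -> (ozero O < a)%O.
Proof. by case/andP=> a1 _; apply: lt_le_trans oone_gt0 a1. Qed.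

Lemma step_index a : step_range a -> index_range a.
Proof. by case/andP=> a1 aw; apply/andP; split=> //; exact: ltW. Qed.

Lemma fund_index a k : step_range a -> index_range (fund A a k).
Proof.
move=> ar; have /andP[f1 fa] := fund_range A k ar; apply/andP; split=> //.
by apply: lt_trans fa _; case/andP: ar.
Qed.

Lemma index_cases a : index_range a -> a = oone O \/ step_range a.
Proof.
case/andP=> + aw; rewrite le_eqVlt => /predU1P[<-|a1]; [by left|right].
by apply/andP.
Qed.

(** For a successor [a] all [a(k)] are the predecessor; for a limit the
    fundamental sequence increases and is cofinal. *)
Lemma fund_cofinal a g : step_range a -> (g < a)%O ->
  exists K, forall k, (K <= k)%N -> (g <= fund A a k)%O.
Proof.
move=> ar ga; have /andP[a1 aw] := ar.
have [[b ab]|nsucc] := pselect (exists b, a = osucc b).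
  exists 0%N => k _; rewrite (fund_succ _ _ ab); apply: lt_osucc.
  by rewrite -ab.
have la : is_limit a.
  split; last by move=> b ab; apply: nsucc; exists b.
  exact: lt_trans (osucc_gt _) a1.
have [K gK] := cofseq_cofinal A aw la ga.
exists K => k; rewrite fund_limit // leq_eqVlt => /predU1P[<- //|Kk].
exact: le_trans gK (ltW (cofseq_strict A aw la Kk)).
Qed.

Lemma I_nonempty a : index_range a -> I_ A a !=set0.
Proof.
move: a; apply: (index_ind (A := A)) => [|a ar IH].
  by exists [::]; exact: I_one.
by have [i Ii] := IH 0%N; exists (0%N :: i); exact: I_step.
Qed.

(** The tree whose leaves are the words of [I_a]: its node [w] carries the ordinal
    [b = a(w_1)...(w_r)], which is 1 exactly at the leaves. *)
Inductive node : O -> seq nat -> O -> Prop :=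
| node_nil a : node a [::] a
| node_cons a k w b : step_range a -> node (fund A a k) w b -> node a (k :: w) b.

Lemma node_rcons a w b k : node a w b -> step_range b ->
  node a (rcons w k) (fund A b k).
Proof.
elim=> {a w b} [a|a l w b ar _ IH] br /=; last by apply: node_cons => //; exact: IH.
by apply: node_cons => //; exact: node_nil.
Qed.

Lemma node_I a w b i : node a w b -> I_ A b i -> I_ A a (w ++ i).
Proof.
by elim=> {a w b} [a|a l w b ar _ IH] // Ii /=; apply: I_step => //; exact: IH.
Qed.

End Ordinals.

(** * The function spaces [S_a] and [H_a^1] *)

Section Spaces.
Context {R : realType} {d : Order.disp_t} {O : ordinals d}.
Variable A : cofinal_sequences O.
Local Notation F := (seq nat -> R^o)%type.
Implicit Types (a b : O) (x y z : F).

Lemma S_oneE x : S_ A (oone O) x -> exists c : R, x = c *: ones R A (oone O).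
Proof. by move=> Sx; inversion Sx as [c|]; [exists c|case: (@step_range1 _ O)]. Qed.

Lemma S_stepE a x : step_range a -> S_ A a x -> exists p s,
  [/\ x = poly_ones A p a + glue s, forall k, S_ A (fund A a k) (s k) &
      finitely_supported s].
Proof.
move=> ar Sx; inversion Sx as [c a1|b p s br Ss fs]; last by exists p, s.
by case: (@step_range1 _ O); rewrite a1.
Qed.

Lemma H1_oneE x : H_ A (oone O) (oone O) x -> S_ A (oone O) x.
Proof. by move=> Hx; inversion Hx as [|? ? ar] => //; case: (@step_range1 _ O). Qed.

Lemma H1_stepE a x : step_range a -> H_ A (oone O) a x -> exists s,
  [/\ x = glue s, forall k, H_ A (oone O) (fund A a k) (s k) &
      finitely_supported s].
Proof.
move=> ar Hx; inversion Hx as [a' x' a1|a' s ? ? Hs fs]; last by exists s.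
by move: ar; rewrite /step_range ltNge a1.
Qed.

Lemma S_glue a (s : nat -> F) : step_range a ->
  (forall k, S_ A (fund A a k) (s k)) -> finitely_supported s -> S_ A a (glue s).
Proof.
by move=> ar Ss fs; rewrite -[glue s]add0r -(poly_ones0 R A a); exact: S_step.
Qed.

Lemma S_poly a (p : {poly R}) : step_range a -> S_ A a (poly_ones A p a).
Proof.
move=> ar; rewrite -[poly_ones _ _ _]addr0 -glue0; apply: S_step => //.
  by move=> k; apply: S_0; exact: fund_index.
exact: finitely_supported0.
Qed.

Lemma H_S b a x : H_ A b a x -> S_ A a x.
Proof. by elim=> {a x} // a s ar _ _ IH fs; exact: S_glue. Qed.

Lemma S_out a x i : S_ A a x -> ~ I_ A a i -> x i = 0.
Proof.
have ones0 b j : ~ I_ A b j -> ones R A b j = 0.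
  by move=> nI; rewrite /ones (_ : _ \in _ = false) //; apply/negbTE; rewrite notin_setE.
move=> Sx; elim: Sx i => {a x} [c|a p s ar _ IH _] i nIi.
  by rewrite [LHS](_ : _ = c * ones R A (oone O) i) // ones0 // mulr0.
case: i nIi => [|k i] nIi; first by rewrite [LHS](_ : _ = 0 + 0) // addr0.
have nIk : ~ I_ A (fund A a k) i by move=> Ii; apply: nIi; exact: I_step.
rewrite [LHS](_ : _ = p.[k.+1%:R] * ones R A (fund A a k) i + s k i) //.
by rewrite ones0 // mulr0 add0r IH.
Qed.

Lemma eventually_zeroP (M : zmodType) (s : nat -> M) : finitely_supported s <->
  exists K, forall k, (K <= k)%N -> s k = 0.
Proof.
split=> [/finite_seqP[r sr]|[K sK]].
  exists (\max_(k <- r) k).+1 => k rk; apply: contrapT => sk.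
  have kr : k \in r by have : [set` r] k by rewrite -sr.
  by have := @leq_bigmax_seq _ r xpredT id k kr isT; rewrite leqNgt rk.
apply: (@sub_finite_set _ _ `I_K) => [k sk /=|]; last exact: finite_II.
by rewrite ltnNge; apply/negP => /sK.
Qed.

(** [H_a^1] consists of the functions of finite support, so membership only
    depends on the zero set; two functions [x], [y] are allowed as bounds in
    order to treat suprema. *)
Lemma H1_solid a x y z : index_range a ->
  H_ A (oone O) a x -> H_ A (oone O) a y ->
  (forall i, x i = 0 -> y i = 0 -> z i = 0) -> H_ A (oone O) a z.
Proof.
move=> ar; move: a ar x y z.
apply: (index_ind (A := A)) => [|a ar IH] x y z Hx Hy xyz.
  apply: H_full => //; have [c xc] := S_oneE (H1_oneE Hx).
  have [c' yc] := S_oneE (H1_oneE Hy).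
  suff -> : z = z [::] *: ones R A (oone O) by exact: S_one.
  apply/funext => i; rewrite [RHS](_ : _ = z [::] * ones R A (oone O) i) //.
  case: i => [|k i]; first by rewrite ones_one mulr1.
  rewrite ones_one mulr0 xyz // ?xc ?yc ones_one.
    by rewrite [LHS](_ : _ = c * 0) // mulr0.
  by rewrite [LHS](_ : _ = c' * 0) // mulr0.
have [s [xs Hs /eventually_zeroP[K sK]]] := H1_stepE ar Hx.
have [u [yu Hu /eventually_zeroP[L uL]]] := H1_stepE ar Hy.
have -> : z = glue (fun k i => z (k :: i)).
  by apply/funext => -[|k i] //; apply: xyz; rewrite ?xs ?yu.
have zsu k i : s k i = 0 -> u k i = 0 -> z (k :: i) = 0.
  by move=> sk uk; apply: xyz; rewrite ?xs ?yu.
apply: H_sum => //; first by case/andP: ar.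
  by move=> k; apply: (IH k (s k) (u k)) => // i; exact: zsu.
apply/eventually_zeroP; exists (maxn K L) => k; rewrite geq_max => /andP[Kk Lk].
by apply/funext => i; apply: zsu; rewrite ?sK ?uL.
Qed.

Lemma poly_eventual_sign (p : {poly R}) : exists e : R, exists K : nat,
  forall k, (K <= k)%N -> `|p.[k.+1%:R]| = e * p.[k.+1%:R].
Proof.
have pos_case (q : {poly R}) : 0 < lead_coef q ->
    exists K : nat, forall k, (K <= k)%N -> 0 <= q.[k.+1%:R].
  move=> q0; have [t qt] := poly_pinfty_gt_lc q0.
  exists (Num.trunc `|t|) => k tk; apply: le_trans (ltW q0) (qt _ _).
  apply: le_trans (ler_norm t) (le_trans (ltW (truncnS_gt _)) _).
  by rewrite ler_nat.
have [p0|p0|p0] := ltgtP (lead_coef p) 0.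
- have [|K Kp] := pos_case (- p); first by rewrite lead_coefN oppr_gt0.
  exists (-1), K => k /Kp; rewrite hornerN oppr_ge0 => pk.
  by rewrite mulN1r ler0_norm.
- have [K Kp] := pos_case _ p0.
  by exists 1, K => k /Kp pk; rewrite mul1r ger0_norm.
- exists 0, 0%N => k _; rewrite mul0r; move/eqP: p0.
  by rewrite lead_coef_eq0 => /eqP ->; rewrite horner0 normr0.
Qed.

Lemma ones_ge0 a i : 0 <= ones R A a i.
Proof. exact: ler0n. Qed.

Lemma S_ones a : index_range a -> S_ A a (ones R A a).
Proof.
move=> /index_cases[->|ar]; first by rewrite -[ones _ _ _]scale1r; exact: S_one.
have -> : ones R A a = poly_ones A 1 a; last exact: S_poly.
rewrite ones_step // /poly_ones; congr glue; apply/funext => k.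
by rewrite hornerE scale1r.
Qed.

Lemma S_add a x y : S_ A a x -> S_ A a y -> S_ A a (x + y).
Proof. by move=> Sx; rewrite -[x]scale1r; exact: S_lin. Qed.

Lemma S_scale a t x : index_range a -> S_ A a x -> S_ A a (t *: x).
Proof. by move=> ar Sx; rewrite -[t *: x]addr0; apply: S_lin => //; exact: S_0. Qed.

(** If [|p| = e p] from some point on, then [|p 1_a + s|] differs from
    [(e p) 1_a] below finitely many children only. *)
Lemma S_abs a x : index_range a -> S_ A a x -> S_ A a (fun i => `|x i|).
Proof.
move=> ar; move: a ar x.
apply: (index_ind (A := A)) => [|a ar IH] x Sx.
  have [c ->] := S_oneE Sx.
  suff -> : (fun i => `|(c *: ones R A (oone O)) i|) = `|c| *: ones R A (oone O).
    exact: S_one.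
  apply/funext => i.
  rewrite [RHS](_ : _ = `|c| * ones R A (oone O) i) //.
  by rewrite -[X in _ = _ * X]ger0_norm ?ones_ge0 // -normrM.
have [p [s [xs Ss /eventually_zeroP[K sK]]]] := S_stepE ar Sx.
have [e [L eL]] := poly_eventual_sign p.
(* the remainder, which vanishes once [|p| = e p] and [s k = 0] *)
pose u k : F := (fun i => `|(p.[k.+1%:R] *: ones R A (fund A a k) + s k) i|)
  + (- e * p.[k.+1%:R]) *: ones R A (fund A a k).
have -> : (fun i => `|x i|) = poly_ones A (e *: p) a + glue u.
  apply/funext => -[|k i].
    rewrite xs [RHS](_ : _ = 0 + 0) // [X in `|X|](_ : _ = 0 + 0) //.
    by rewrite addr0 normr0.
  rewrite [RHS](_ : _ = (e *: p).[k.+1%:R] * ones R A (fund A a k) i +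
    (`|x (k :: i)| + - e * p.[k.+1%:R] * ones R A (fund A a k) i)) ?xs //.
  by rewrite hornerZ [RHS]addrC -[RHS]addrA -mulrDl mulNr addNr mul0r addr0.
apply: S_step => // [k|].
  have fr := fund_index A k ar; have So := S_ones fr.
  by apply: S_add; [apply: IH; apply: S_lin|exact: S_scale].
apply/eventually_zeroP; exists (maxn K L) => k; rewrite geq_max => /andP[Kk Lk].
apply/funext => i; rewrite /u sK // addr0.
rewrite [LHS](_ : _ = `|p.[k.+1%:R] * ones R A (fund A a k) i| +
   - e * p.[k.+1%:R] * ones R A (fund A a k) i) // normrM eL //.
by rewrite [X in _ * X + _]ger0_norm ?ones_ge0 // -mulrDl mulNr addrN mul0r.
Qed.

Lemma S_max a x y : index_range a -> S_ A a x -> S_ A a y ->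
  S_ A a (fun i => Num.max (x i) (y i)).
Proof.
move=> ar Sx Sy.
have -> : (fun i => Num.max (x i) (y i)) =
    2^-1 *: ((x + y) + (fun i => `|(-1 *: y + x) i|)).
  apply/funext => i; rewrite [LHS]maxr_absE.
  rewrite [RHS](_ : _ = 2^-1 * (x i + y i + `|-1 * y i + x i|)) //.
  by rewrite mulN1r [- _ + _]addrC mulrC.
apply: S_scale => //; apply: S_add; first exact: S_add.
by apply: S_abs => //; exact: S_lin.
Qed.

(** The inclusion of [R^(I_b)], for [b] the ordinal at the node [w], as a factor
    of [R^(I_a)]. *)
Definition graft (w : seq nat) x : F := fun i =>
  if seq.prefix w i then x (drop (size w) i) else 0.

Lemma graft_nil x : graft [::] x = x.
Proof. by apply/funext => i; rewrite /graft prefix0s drop0. Qed.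

Lemma graft_cons k w x : graft (k :: w) x =
  glue (fun l => if l == k then graft w x else 0).
Proof.
by apply/funext => -[|l i] //=; rewrite /graft /= eq_sym; case: eqP.
Qed.

Lemma graft_rcons w k x : graft (rcons w k) x =
  graft w (glue (fun l => if l == k then x else 0)).
Proof.
elim: w => [|l w IH] /=; last by rewrite !graft_cons IH.
by rewrite graft_cons !graft_nil.
Qed.

Lemma graft_cat w x i : graft w x (w ++ i) = x i.
Proof. by rewrite /graft prefix_prefix drop_size_cat. Qed.

Lemma graft_out w x i : ~~ seq.prefix w i -> graft w x i = 0.
Proof. by rewrite /graft => /negbTE ->. Qed.

Lemma graftD w x y : graft w (x + y) = graft w x + graft w y.
Proof.
apply/funext => i; rewrite [RHS](_ : _ = graft w x i + graft w y i) // /graft.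
by case: ifP; rewrite ?addr0.
Qed.

Lemma finitely_supported_single (M : zmodType) (x : M) (k : nat) :
  finitely_supported (fun l => if l == k then x else 0).
Proof.
by apply/eventually_zeroP; exists k.+1 => l kl; rewrite gtn_eqF.
Qed.

Lemma node_index a w b : node A a w b -> index_range b -> index_range a.
Proof. by move=> nab br; case: nab br => // *; exact: step_index. Qed.

Lemma S_graft a w b x : node A a w b -> S_ A b x -> S_ A a (graft w x).
Proof.
elim=> {a w b} [a|a k w b ar _ IH] Sx; first by rewrite graft_nil.
rewrite graft_cons; apply: S_glue (finitely_supported_single _ _) => // l.
by case: eqP => [->|_]; [exact: IH|apply: S_0; exact: fund_index].
Qed.

Lemma H1_graft a w b x : node A a w b -> H_ A (oone O) b x ->
  H_ A (oone O) a (graft w x).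
Proof.
elim=> {a w b} [a|a k w b ar _ IH] Sx; first by rewrite graft_nil.
rewrite graft_cons; apply: H_sum (finitely_supported_single _ _) => //.
  by case/andP: ar.
move=> l; case: eqP => [->|_]; first exact: IH.
by apply: H_0 => //; exact: fund_index.
Qed.

Lemma S_node a w b x : node A a w b -> S_ A a x -> S_ A b (fun i => x (w ++ i)).
Proof.
move=> nab; elim: nab x => {a w b} // a k w b ar _ IH x Sx.
have [p [s [-> Ss _]]] := S_stepE ar Sx.
have So := S_ones (fund_index A k ar).
exact: (IH (p.[k.+1%:R] *: ones R A (fund A a k) + s k) (S_lin _ So (Ss k))).
Qed.

Lemma H1_node a w b x : node A a w b -> H_ A (oone O) a x ->
  H_ A (oone O) b (fun i => x (w ++ i)).
Proof.
move=> nab; elim: nab x => {a w b} // a k w b ar _ IH x Hx.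
have [s [-> Hs _]] := H1_stepE ar Hx.
exact: (IH (s k)).
Qed.

End Spaces.

(** * Coordinates of vectors of the direct sum *)

Section Coordinates.
Context {R : realType} {d : Order.disp_t} {O : ordinals d}.
Variable A : cofinal_sequences O.
Local Notation F := (seq nat -> R^o)%type.
Local Notation X := (V_omega1 R A).
Implicit Types (a b c l g : O) (v w m xi : V_omega1_space R A).

Definition coord1 v a : F := (v a).1.
Definition coord2 v a : F := (v a).2.

Lemma coord1D v w a i : coord1 (v + w) a i = coord1 v a i + coord1 w a i.
Proof. by []. Qed.
Lemma coord2D v w a i : coord2 (v + w) a i = coord2 v a i + coord2 w a i.
Proof. by []. Qed.
Lemma coord1N v a i : coord1 (- v) a i = - coord1 v a i.
Proof. by []. Qed.
Lemma coord2N v a i : coord2 (- v) a i = - coord2 v a i.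
Proof. by []. Qed.
Lemma coord1Mn v n a i : coord1 (v *+ n) a i = coord1 v a i *+ n.
Proof. by elim: n => // n IH; rewrite !mulrS coord1D IH. Qed.
Lemma coord2Mn v n a i : coord2 (v *+ n) a i = coord2 v a i *+ n.
Proof. by elim: n => // n IH; rewrite !mulrS coord2D IH. Qed.

Definition coordE := (coord1D, coord2D, coord1N, coord2N, coord1Mn, coord2Mn).

Lemma V_omega1_setP v : V_omega1_set A v.
Proof. by have := V_omega1_valP v; rewrite inE. Qed.

Lemma coord_out v a : ~ index_range a -> v a = 0.
Proof. by have [_ + _] := V_omega1_setP v; apply. Qed.

Lemma coord1_H v a : index_range a -> H_ A (oone O) a (coord1 v a).
Proof. by have [_ _ +] := V_omega1_setP v => /[apply] -[]. Qed.

Lemma coord2_S v a : index_range a -> S_ A a (coord2 v a).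
Proof. by have [_ _ +] := V_omega1_setP v => /[apply] -[_ /H_S]. Qed.

Lemma coord_outI v a i : ~ (index_range a /\ I_ A a i) ->
  coord1 v a i = 0 /\ coord2 v a i = 0.
Proof.
move=> nai; have [ar|nar] := pselect (index_range a); last first.
  by rewrite /coord1 /coord2 coord_out.
have nIi : ~ I_ A a i by move=> Ii; apply: nai.
by split; [apply: S_out (H_S (coord1_H v ar)) _|apply: S_out (coord2_S v ar) _].
Qed.

Lemma V_omega1_ext v w :
  (forall a i, coord1 v a i = coord1 w a i) ->
  (forall a i, coord2 v a i = coord2 w a i) -> v = w.
Proof.
move=> e1 e2; apply: val_inj; apply/funext => a /=.
rewrite [LHS]surjective_pairing [RHS]surjective_pairing.
by congr pair; apply/funext => i; [exact: e1|exact: e2].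
Qed.

Lemma V_omega1_ex (f : O -> F * F) : V_omega1_set A f ->
  exists v, V_omega1_val v = f.
Proof.
move=> Vf; have fP : f \in V_omega1_pred A by rewrite inE.
by exists (VOmega1 fP).
Qed.

(** * The lattice structure *)

Definition lex_ge0 (s t : R) := 0 < s \/ (0 = s /\ 0 <= t).

Lemma V_omega1_posP v : pos X v <-> forall a i, index_range a -> I_ A a i ->
  lex_ge0 (coord1 v a i) (coord2 v a i).
Proof. by split=> pv a => [i ar Ii|ar i Ii]; exact: pv. Qed.

Lemma lex_anti (s t : R) : lex_ge0 s t -> lex_ge0 (- s) (- t) -> s = 0 /\ t = 0.
Proof.
case=> [s0|[<- t0]]; case.
- by rewrite oppr_gt0 ltNge (ltW s0).
- by case=> /esym/eqP; rewrite oppr_eq0 gt_eqF.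
- by rewrite oppr0 ltxx.
- by case=> _; rewrite oppr_ge0 => t0'; split=> //; apply/eqP; rewrite eq_le t0 t0'.
Qed.

Definition lex_max2 (s1 s2 t1 t2 : R) :=
  if s1 < t1 then t2 else if t1 < s1 then s2 else Num.max s2 t2.

Lemma lex_maxC (s1 s2 t1 t2 : R) : lex_max2 s1 s2 t1 t2 = lex_max2 t1 t2 s1 s2.
Proof. by rewrite /lex_max2; case: (ltgtP s1 t1) => // _; rewrite maxC. Qed.

Lemma lex_max_ge (s1 s2 t1 t2 : R) :
  lex_ge0 (Num.max s1 t1 - s1) (lex_max2 s1 s2 t1 t2 - s2).
Proof.
rewrite /lex_max2 /lex_ge0; case: (ltgtP s1 t1) => st.
- by left; rewrite subr_gt0.
- by right; rewrite !subrr.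
- by right; rewrite st subrr subr_ge0 le_max lexx.
Qed.

Lemma lex_max_le (s1 s2 t1 t2 r1 r2 : R) :
  lex_ge0 (r1 - s1) (r2 - s2) -> lex_ge0 (r1 - t1) (r2 - t2) ->
  lex_ge0 (r1 - Num.max s1 t1) (r2 - lex_max2 s1 s2 t1 t2).
Proof.
rewrite /lex_max2; case: (ltgtP s1 t1) => // st.
case=> [p _|[/esym/eqP]]; first by left.
rewrite subr_eq0 => /eqP ->; rewrite subr_ge0 => s2r [|[_]].
  by rewrite st subrr ltxx.
by rewrite subr_ge0 => t2r; right; rewrite subrr subr_ge0 ge_max s2r.
Qed.

(** The second coordinate of the lexicographic maximum is the pointwise maximum
    of the second coordinates, except where the first coordinates differ, which
    happens on a finite set. *)
Lemma V_omega1_lattice : is_vector_lattice X.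
Proof.
split=> [x /V_omega1_posP px /V_omega1_posP pNx|x y].
  suff x0 a i : coord1 x a i = 0 /\ coord2 x a i = 0.
    by apply: V_omega1_ext => a i; case: (x0 a i).
  have [[ar Ii]|] := pselect (index_range a /\ I_ A a i).
    exact: lex_anti (px a i ar Ii) (pNx a i ar Ii).
  exact: coord_outI.
pose f a : F * F := (fun i => Num.max (coord1 x a i) (coord1 y a i),
  fun i => lex_max2 (coord1 x a i) (coord2 x a i) (coord1 y a i) (coord2 y a i)).
have f0 a : V_omega1_val x a = 0 -> V_omega1_val y a = 0 -> f a = 0.
  move=> xa ya; rewrite /f /coord1 /coord2 xa ya.
  by congr pair; apply/funext => i; rewrite /lex_max2 /= ?ltxx maxxx.
have Vf : V_omega1_set A f.
  split=> [|a nar|a ar].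
  - have [fx _ _] := V_omega1_setP x; have [fy _ _] := V_omega1_setP y.
    have fU : finite_set ([set a | V_omega1_val x a <> 0] `|`
                          [set a | V_omega1_val y a <> 0]) by rewrite finite_setU.
    apply: sub_finite_set fU => a /= fa; have [xa|] := pselect (V_omega1_val x a = 0).
      by right=> ya; apply: fa; exact: f0.
    by left.
  - by apply: f0; exact: coord_out.
  - have H1x := coord1_H x ar; have H1y := coord1_H y ar.
    split; first by apply: H1_solid H1x H1y _ => // i /= -> ->; rewrite maxxx.
    apply: H_full => //.
    pose m : F := fun i => Num.max (coord2 x a i) (coord2 y a i).
    (* the correction, supported where the first coordinates differ *)
    pose e : F := fun i => (f a).2 i - m i.
    have -> : (f a).2 = m + e.
      by apply/funext => i; rewrite [RHS](_ : _ = m i + e i) // addrC subrK.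
    apply: S_add; first by apply: S_max => //; exact: coord2_S.
    apply: H_S; apply: H1_solid H1x H1y _ => // i x0 y0.
    by rewrite /e /= /lex_max2 x0 y0 ltxx subrr.
have [z zf] := V_omega1_ex Vf.
have z1 a i : coord1 z a i = Num.max (coord1 x a i) (coord1 y a i).
  by rewrite {1}/coord1 zf.
have z2 a i : coord2 z a i =
    lex_max2 (coord1 x a i) (coord2 x a i) (coord1 y a i) (coord2 y a i).
  by rewrite {1}/coord2 zf.
exists z; split.
- by apply/V_omega1_posP => a i _ _; rewrite !coordE z1 z2; exact: lex_max_ge.
- apply/V_omega1_posP => a i _ _; rewrite !coordE z1 z2 maxC lex_maxC.
  exact: lex_max_ge.
- move=> w /V_omega1_posP wx /V_omega1_posP wy; apply/V_omega1_posP => a i ar Ii.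
  have := wx a i ar Ii; have := wy a i ar Ii; rewrite !coordE z1 z2 => pwy pwx.
  exact: lex_max_le.
Qed.

(** * First coordinates of the ideals *)

Lemma bounded_multiples (x b : R) :
  (forall n, (0 < n)%N -> 0 <= x *+ n + b /\ 0 <= - (x *+ n) + b) -> x = 0.
Proof.
move=> H; apply/eqP; apply: contraT => x0.
pose n := (Num.trunc (b / `|x|)).+1.
have : b < `|x| *+ n.
  by rewrite -mulr_natr mulrC -ltr_pdivrMr ?normr_gt0 // truncnS_gt.
have [p q] := H n isT.
rewrite -normrMn ltNge ler_norml => /negP[]; apply/andP; split.
  by rewrite -subr_ge0 opprK.
by rewrite -subr_ge0 addrC.
Qed.

(** The corrections have no first coordinate by induction, so all multiples of
    the first coordinate of [v] are bounded by that of [xi]. *)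
Lemma Nideal_coord1 l v : Nideal X l v -> forall a i, coord1 v a i = 0.
Proof.
elim: (ord_wf l) v => {}l _ IH v.
have [->|l0] := ozeroVgt0 l; first by rewrite Nideal0 => ->.
move=> /(Nideal_posP _ l0)[xi pxi px] a i.
have [[ar Ii]|nai] := pselect (index_range a /\ I_ A a i); last first.
  by case: (coord_outI v nai).
have M0 m : Mideal X l m -> coord1 m a i = 0 by move=> [g gl Nm]; apply: IH Nm _ _.
apply: (@bounded_multiples _ (coord1 xi a i)) => n n0.
have lex0 s t : lex_ge0 s t -> 0 <= s by case=> [/ltW|[<-]].
have [[m Mm /V_omega1_posP pm] [m' Mm' /V_omega1_posP pm']] := px n n0.
have := lex0 _ _ (pm a i ar Ii); have := lex0 _ _ (pm' a i ar Ii).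
by rewrite !coordE (M0 m) // (M0 m') // !addr0.
Qed.

(** * Lower bound: grafts of [S_a] are in [N_a] *)

Definition single a (f1 f2 : F) : O -> F * F :=
  fun b => if b == a then (f1, f2) else 0.

Lemma coord1_single v a (f1 f2 : F) b i : V_omega1_val v = single a f1 f2 ->
  coord1 v b i = if b == a then f1 i else 0.
Proof. by rewrite /coord1 => ->; rewrite /single; case: eqP. Qed.

Lemma coord2_single v a (f1 f2 : F) b i : V_omega1_val v = single a f1 f2 ->
  coord2 v b i = if b == a then f2 i else 0.
Proof. by rewrite /coord2 => ->; rewrite /single; case: eqP. Qed.

Lemma single_ex a f1 f2 : index_range a -> H_ A (oone O) a f1 -> S_ A a f2 ->
  exists v, V_omega1_val v = single a f1 f2.
Proof.
move=> ar H1 S2; apply: V_omega1_ex; split.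
- apply: (@sub_finite_set _ _ [set a]); last exact: finite_set1.
  by move=> b /=; rewrite /single; case: eqP.
- by move=> b nbr; rewrite /single; case: eqP => // ba; case: nbr; rewrite ba.
- move=> b br; rewrite /single; case: eqP => [->|_].
    by split=> //; exact: H_full.
  by split; apply: H_0 => //; case/andP: br.
Qed.

(** Membership of a bare function in [N_l]; this avoids carrying proofs that the
    function is a vector of the direct sum. *)
Definition inN l (f : O -> F * F) := exists2 v, V_omega1_val v = f & Nideal X l v.
Definition inM l (f : O -> F * F) := exists2 v, V_omega1_val v = f & Mideal X l v.

Lemma inN_D l (f h : O -> F * F) : inN l f -> inN l h -> inN l (f + h).
Proof.
move=> [v <- Nv] [w <- Nw]; exists (v + w) => //.
by rewrite -[v]scale1r; have [_] := Nideal_subspace X l; apply.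
Qed.

Lemma inM_D l (f h : O -> F * F) : (ozero O < l)%O -> inM l f -> inM l h -> inM l (f + h).
Proof.
move=> l0 [v <- Nv] [w <- Nw]; exists (v + w) => //.
by rewrite -[v]scale1r; have [_] := Mideal_subspace X l0; apply.
Qed.

Lemma inN_0 l : inN l 0.
Proof. by exists 0 => //; have [] := Nideal_subspace X l. Qed.

Lemma inM_inN l f : inM l f -> inN l f.
Proof. by move=> [v <- Mv]; exists v => //; exact: Mideal_sub. Qed.

Lemma inN_inM g l f : (g < l)%O -> inN g f -> inM l f.
Proof. by move=> gl [v <- Nv]; exists v => //; exists g. Qed.

Lemma single0 a : single a 0 0 = 0.
Proof. by apply/funext => b; rewrite /single; case: eqP. Qed.

Lemma singleD a (f h : F) : single a 0 (f + h) = single a 0 f + single a 0 h.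
Proof.
apply/funext => b; rewrite [RHS](_ : _ = single a 0 f b + single a 0 h b) //.
rewrite /single; case: eqP => _; last by rewrite addr0.
by rewrite [RHS](_ : _ = (0 + 0, f + h)) // addr0.
Qed.

(** A finite sum of grafts at children of [w]; the ordinals of these are below
    [a]. *)
Lemma inM_glue c (w : seq nat) a : step_range a -> node A c w a ->
  (forall k (f : F), S_ A (fund A a k) f ->
     inN (fund A a k) (single c 0 (graft (rcons w k) f))) ->
  forall s : nat -> F, (forall k, S_ A (fund A a k) (s k)) -> finitely_supported s ->
  inM a (single c 0 (graft w (glue s))).
Proof.
move=> ar cwa IH s Ss fs; have [K] := proj1 (eventually_zeroP s) fs.
have a0 := index_gt0 (step_index ar).
elim: K s Ss {fs} => [|K IHK] s Ss sK.
  have -> : s = 0 by apply/funext => k; exact: sK.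
  rewrite glue0 (_ : graft w 0 = 0) ?single0; last first.
    by apply/funext => i; rewrite /graft; case: ifP.
  exact: inN_inM a0 (inN_0 _).
(* Split off the last member [s K], a graft at the child [K]. *)
pose s' k := if k == K then 0 else s k.
have -> : glue s = glue s' + glue (fun k => if k == K then s K else 0).
  apply/funext => -[|k i]; first by rewrite [RHS](_ : _ = 0 + 0) // addr0.
  rewrite [RHS](_ : _ = s' k i + (if k == K then s K else 0) i) // /s' /=.
  by case: eqP => [->|_]; [rewrite add0r|rewrite addr0].
rewrite graftD singleD -graft_rcons; apply: inM_D => //.
  apply: IHK => k; rewrite /s'; case: eqP => [_|/eqP kK] //.
    by apply: S_0; exact: fund_index.
  by move=> Kk; apply: sK; rewrite ltn_neqAle eq_sym kK.
by apply: inN_inM (IH K _ (Ss K)); case/andP: (fund_range A K ar).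
Qed.

(** The pointwise inequality behind the domination of [p] by [X (1 + p^2)]. The
    argument of [p] at the [k]-th child is [k + 1]; for [k < n] the last summand
    makes up for the smallness of the second one. *)
Lemma poly_dominated (t : R) (n k : nat) :
  0 <= t *+ n + k.+1%:R * (1 + t ^+ 2) +
       (if (k < n)%N then n%:R * (1 + t ^+ 2) else 0).
Proof.
have t1 : 0 <= 1 + t ^+ 2 by rewrite addr_ge0 // sqr_ge0.
have tt : 0 <= t + (1 + t ^+ 2) by nra.
have -> : t *+ n = n%:R * t by rewrite mulr_natl.
have n0 : 0 <= n%:R :> R := ler0n _ _.
have k0 : 0 <= k.+1%:R :> R := ler0n _ _.
have [kn|nk] := ltnP; last have nk' : n%:R <= k.+1%:R :> R by rewrite ler_nat ltnW.
  have : 0 <= n%:R * (t + (1 + t ^+ 2)) by exact: mulr_ge0.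
  have : 0 <= k.+1%:R * (1 + t ^+ 2) by exact: mulr_ge0.
  lra.
have : 0 <= n%:R * (t + (1 + t ^+ 2)) by exact: mulr_ge0.
have : n%:R * (1 + t ^+ 2) <= k.+1%:R * (1 + t ^+ 2) by exact: ler_wpM2r.
lra.
Qed.

(** [(0, f)] is dominated by [(1_1, 0)] grafted at the same leaf. *)
Lemma inN_one c (w : seq nat) (f : F) : node A c w (oone O) ->
  S_ A (oone O) f -> inN (oone O) (single c 0 (graft w f)).
Proof.
move=> cw Sf; have o1 : index_range (oone O) := oone_index; have cr := node_index cw o1.
have [v vf] : exists v, V_omega1_val v = single c 0 (graft w f).
  by apply: single_ex => //; [exact: H_0|exact: S_graft cw Sf].
have [xi xif] : exists xi, V_omega1_val xi = single c (graft w (ones R A (oone O))) 0.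
  apply: single_ex => //; last exact: S_0.
  by apply: H1_graft cw _; apply: H_full => //; exact: S_ones.
(* [e] is the sign of the multiple of [v]; [e = 0] is the positivity of [xi]. *)
have key e n a i : coord1 v a i = 0 /\ lex_ge0 (coord1 xi a i) (coord2 v a i *+ n * e).
  rewrite (coord1_single _ _ vf) (coord2_single _ _ vf) (coord1_single _ _ xif).
  split; first by case: eqP.
  case: eqP => _; last by right; rewrite mul0rn mul0r.
  have [/prefixP[j ->]|wi] := boolP (seq.prefix w i); last first.
    by rewrite !graft_out //; right; rewrite mul0rn mul0r.
  rewrite !graft_cat; case: j => [|k j]; first by left; rewrite ones_one ltr01.
  right; rewrite ones_one; split=> //.
  suff -> : f (k :: j) = 0 by rewrite mul0rn mul0r.
  have [b ->] := S_oneE Sf; rewrite ones_one.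
  by rewrite [LHS](_ : _ = b * 0) // mulr0.
exists v => //; apply/(Nideal_posP _ (oone_gt0)).
have xi2 a i : coord2 xi a i = 0 by rewrite (coord2_single _ _ xif); case: eqP.
have M0 : Mideal X (oone O) 0 by exists (ozero O); [exact: oone_gt0|rewrite Nideal0].
exists xi => [|n n0].
  apply/V_omega1_posP => a i ar Ii; rewrite xi2.
  by have [_] := key 0 0%N a i; rewrite mulr0.
split; exists 0 => //; apply/V_omega1_posP => a i ar Ii; rewrite addr0 !coordE xi2 addr0.
  by have [-> +] := key 1 n a i; rewrite mul0rn add0r mulr1.
by have [-> +] := key (-1) n a i; rewrite mul0rn oppr0 add0r mulrN1.
Qed.

(** [X (1 + p^2)] is too small to dominate [n p] below the first [n] children;
    there the domination is corrected by an element of [M_a], which exists by the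
    hypothesis because only finitely many children are concerned. *)
Lemma inN_poly c (w : seq nat) a (p : {poly R}) : step_range a -> node A c w a ->
  (forall s : nat -> F, (forall k, S_ A (fund A a k) (s k)) -> finitely_supported s ->
     inM a (single c 0 (graft w (glue s)))) ->
  inN a (single c 0 (graft w (poly_ones A p a))).
Proof.
move=> ar cw inM_s; have cr := node_index cw (step_index ar).
have exv q : exists v, V_omega1_val v = single c 0 (graft w (poly_ones A q a)).
  apply: single_ex => //; last by apply: S_graft cw _; exact: S_poly.
  by apply: H_0.
have [v vf] := exv p; have [xi xif] := exv ('X * (1 + p ^+ 2)).
exists v => //; apply/(Nideal_posP _ (index_gt0 (step_index ar))).
have q_at k : ('X * (1 + p ^+ 2)).[k.+1%:R] = k.+1%:R * (1 + p.[k.+1%:R] ^+ 2).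
  by rewrite !hornerE.
have single_at u q b i : V_omega1_val u = single c 0 (graft w (poly_ones A q a)) ->
    coord1 u b i = 0.
  by move=> uq; rewrite (coord1_single _ _ uq); case: eqP.
exists xi => [|n n0].
  apply/V_omega1_posP => b i br Ii; right.
  rewrite (single_at _ _ _ _ xif) (coord2_single _ _ xif); split=> //.
  case: eqP => // _; have [/prefixP[[|k j] ->]|wi] := boolP (seq.prefix w i).
  - by rewrite graft_cat.
  - rewrite graft_cat.
    rewrite [leRHS](_ : _ = ('X * (1 + p ^+ 2)).[k.+1%:R] * ones R A (fund A a k) j) //.
    by rewrite q_at !mulr_ge0 ?ones_ge0 // addr_ge0 // sqr_ge0.
  - by rewrite graft_out.
pose s k := (if (k < n)%N then n%:R * (1 + p.[k.+1%:R] ^+ 2) else 0)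
  *: ones R A (fund A a k).
have [m mf Mm] : inM a (single c 0 (graft w (glue s))).
  apply: inM_s => [k|].
    by have fr := fund_index A k ar; apply: S_scale => //; exact: S_ones.
  by apply/eventually_zeroP; exists n => k; rewrite /s ltnNge => ->; rewrite scale0r.
(* [e] is the sign of the multiple of [v]; the same [m] serves both signs. *)
have key (e : R) b i : (e = 1 \/ e = -1) ->
    0 <= e * (coord2 v b i *+ n) + coord2 xi b i + coord2 m b i.
  move=> e1; rewrite (coord2_single _ _ vf) (coord2_single _ _ xif) (coord2_single _ _ mf).
  case: eqP => _; last by rewrite mul0rn mulr0 !addr0.
  have [/prefixP[[|k j] ->]|wi] := boolP (seq.prefix w i).
  - by rewrite !graft_cat mul0rn mulr0 !addr0.
  - rewrite !graft_cat.
    set o := ones R A (fund A a k) j; set t := p.[k.+1%:R].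
    rewrite [leRHS](_ : _ = e * ((t * o) *+ n) + ('X * (1 + p ^+ 2)).[k.+1%:R] * o
      + (if (k < n)%N then n%:R * (1 + t ^+ 2) else 0) * o) //.
    have -> : e * ((t * o) *+ n) = (e * t) *+ n * o by rewrite mulrnAl mulrnAr mulrA.
    rewrite q_at -/t -!mulrDl; apply: mulr_ge0; last exact: ones_ge0.
    have <- : (e * t) ^+ 2 = t ^+ 2 by case: e1 => ->; rewrite ?mul1r // mulN1r sqrrN.
    exact: poly_dominated.
  - by rewrite !graft_out // mul0rn mulr0 !addr0.
have m1 b i : coord1 m b i = 0 by rewrite (coord1_single _ _ mf); case: eqP.
split; exists m => //; apply/V_omega1_posP => b i br Ii; right; rewrite !coordE;
  rewrite (single_at _ _ _ _ vf) (single_at _ _ _ _ xif) m1 mul0rn ?oppr0 !addr0; split=> //.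
  by rewrite -[_ *+ n]mul1r; apply: key; left.
by rewrite -mulN1r; apply: key; right.
Qed.

Lemma inN_single a : index_range a -> forall c (w : seq nat), node A c w a ->
  forall f : F, S_ A a f -> inN a (single c 0 (graft w f)).
Proof.
move: a; apply: (index_ind (A := A)) => [|a ar IH] c w cw f Sf.
  exact: inN_one.
have [p [s [-> Ss fs]]] := S_stepE ar Sf.
have inM_s := inM_glue ar cw (fun k => IH k _ _ (node_rcons k cw ar)).
by rewrite graftD singleD; apply: inN_D; [exact: inN_poly|apply/inM_inN/inM_s].
Qed.

(** Induction on a list [s] of indices containing the support of [f]. *)
Lemma inN_omega1 (s : seq O) (f : O -> F * F) : V_omega1_set A f ->
  (forall a, (f a).1 = 0) -> (forall a, a \notin s -> f a = 0) -> inN (omega1 O) f.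
Proof.
elim: s f => [|b s IH] f Vf f1 fs.
  by rewrite (_ : f = 0); [exact: inN_0|apply/funext => a; exact: fs].
have [br|nbr] := pselect (index_range b); last first.
  apply: IH => // a as_; have [->|ab] := eqVneq a b; first by case: Vf => _ + _; apply.
  by apply: fs; rewrite inE (negbTE ab).
pose h a := if a == b then 0 else f a.
have -> : f = h + single b 0 (f b).2.
  apply/funext => a; rewrite [RHS](_ : _ = h a + single b 0 (f b).2 a) //.
  rewrite /h /single; case: eqP => [->|_]; last by rewrite addr0.
  by rewrite add0r -(f1 b) -surjective_pairing.
have [ff fo fV] := Vf.
apply: inN_D.
  apply: IH.
  - split=> [|a nar|a ar].
    + by apply: sub_finite_set ff => a /=; rewrite /h; case: eqP.
    + by rewrite /h; case: eqP => // _; exact: fo.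
    + rewrite /h; case: eqP => _; last exact: fV.
      by split; apply: H_0 => //; case/andP: ar.
  - by move=> a; rewrite /h; case: eqP.
  - move=> a as_; rewrite /h; case: eqP => // /eqP ab.
    by apply: fs; rewrite inE (negbTE ab).
apply: inM_inN; apply: (@inN_inM b); first by case/andP: br.
rewrite -[(f b).2]graft_nil; apply: inN_single => //; first exact: node_nil.
by have [_ /H_S] := fV b br.
Qed.

Lemma Nideal_omega1 v : (forall a i, coord1 v a i = 0) -> Nideal X (omega1 O) v.
Proof.
move=> v1; have [w /val_inj <-//] : inN (omega1 O) (V_omega1_val v).
have [fv _ _] := V_omega1_setP v; move/finite_seqP: (fv) => [s sv].
apply: (@inN_omega1 s); first exact: V_omega1_setP.
  by move=> a; apply/funext => i; exact: v1.
move=> a as_; apply: contrapT => va; move/negP: as_; apply.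
by have : [set` s] a by rewrite -sv.
Qed.

(** * Upper bound: vanishing below nodes of large ordinal *)

(** An element of [N_g] vanishes somewhere below a node of ordinal [b > g]. At a
    leaf, [b = 1] forces [g = 0], and [N_0] is zero; elsewhere the vanishing below
    almost all children is assumed. *)
Lemma Nideal_zero_point g b c (w : seq nat) m : index_range b -> (g < b)%O ->
  Nideal X g m ->
  (step_range b -> exists K, forall k, (K <= k)%N -> forall i, coord2 m c (w ++ k :: i) = 0) ->
  exists2 i, I_ A b i & coord2 m c (w ++ i) = 0.
Proof.
move=> br gb Nm IH; have [bone|bs] := index_cases br.
  have g0 : g = ozero O.
    by apply/eqP; rewrite eq_le ozero_le andbT; apply: lt_osucc; rewrite -/(oone O) -bone.
  have [i Ii] := I_nonempty A br; exists i => //.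
  by move: Nm; rewrite g0 Nideal0 => ->.
have [K mK] := IH bs.
have [j Ij] := I_nonempty A (fund_index A K bs).
by exists (K :: j); [exact: I_step|exact: mK].
Qed.

(** The point is that the threshold for [k] does not depend on [n]: it comes from
    the shapes of [v] and [xi] and from [l <= a(k)] only. The correction, which
    depends on [n], then vanishes at some word below the [k]-th child, where [v]
    and [xi] take the same values [p(k)] and [q(k)] as at any other word. *)
Lemma Nideal_node l v c (w : seq nat) a : Nideal X l v -> node A c w a -> step_range a ->
  (l < a)%O -> exists K, forall k, (K <= k)%N -> forall i, coord2 v c (w ++ k :: i) = 0.
Proof.
elim: (ord_wf l) v c w a => {}l _ IH v c w a Nv cw ar la.
have [l0|l0] := ozeroVgt0 l.
  by exists 0%N => k _ i; move: Nv; rewrite l0 Nideal0 => ->.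
have v1 := Nideal_coord1 Nv.
move: Nv => /(Nideal_posP _ l0)[xi pxi px].
have cr := node_index cw (step_index ar).
have at_node u : exists p s, (forall k i, coord2 u c (w ++ k :: i) =
    p.[k.+1%:R] * ones R A (fund A a k) i + s k i) /\ finitely_supported s.
  have [p [s [us _ fs]]] := S_stepE ar (S_node cw (coord2_S u cr)).
  by exists p, s; split=> // k i; have := congr1 (fun f => f (k :: i)) us.
have [p [s [vE /eventually_zeroP[K1 sK]]]] := at_node v.
have [q [u [xiE /eventually_zeroP[K2 uK]]]] := at_node xi.
have [t [xi1E _ /eventually_zeroP[K3 tK]]] := H1_stepE ar (H1_node cw (coord1_H xi cr)).
have [K4 lK] := fund_cofinal A ar la.
exists (maxn (maxn K1 K2) (maxn K3 K4)) => k.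
rewrite !geq_max => /andP[/andP[k1 k2] /andP[k3 k4]].
have fr := fund_index A k ar.
have xi1 i : coord1 xi c (w ++ k :: i) = 0.
  by have := congr1 (fun f => f (k :: i)) xi1E; rewrite /= tK.
have cwk := node_rcons k cw ar.
have zeroM m : Mideal X l m -> exists i, [/\ I_ A c (w ++ k :: i),
    coord1 m c (w ++ k :: i) = 0, coord2 m c (w ++ k :: i) = 0 &
    ones R A (fund A a k) i = 1].
  move=> [g gl Nm].
  have [i Ii mi] := Nideal_zero_point fr (lt_le_trans gl (lK k k4)) Nm
    (fun fs => IH g gl _ _ _ _ Nm cwk fs (lt_le_trans gl (lK k k4))).
  exists i; rewrite cat_rcons in mi; split=> //.
  - by rewrite -cat_rcons; apply: node_I cwk Ii.
  - exact: Nideal_coord1 Nm _ _.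
  - by rewrite /ones mem_set.
suff pk : p.[k.+1%:R] = 0 by move=> i; rewrite vE sK // pk mul0r addr0.
apply: (@bounded_multiples _ q.[k.+1%:R]) => n n0.
have lex00 (y : R) : lex_ge0 0 y -> 0 <= y by case=> [|[]//]; rewrite ltxx.
have [[m Mm /V_omega1_posP pm] [m' Mm' /V_omega1_posP pm']] := px n n0.
split.
  have [i [Ii m1 m2 oi]] := zeroM m Mm.
  have := pm _ _ cr Ii.
  rewrite !coordE v1 xi1 m1 m2 mul0rn !addr0 => /lex00.
  by rewrite vE xiE sK // uK // oi !mulr1 !addr0.
have [i [Ii m1 m2 oi]] := zeroM m' Mm'.
have := pm' _ _ cr Ii.
rewrite !coordE v1 xi1 m1 m2 mul0rn oppr0 !addr0 => /lex00.
by rewrite vE xiE sK // uK // oi !mulr1 !addr0.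
Qed.

End Coordinates.

(** * The type of the direct sum *)

Theorem corollary4p2 (R : realType) (d : Order.disp_t) (O : ordinals d)
    (A : cofinal_sequences O) :
  is_vector_lattice (V_omega1 R A) /\
  almost_archimedeanization_type (V_omega1 R A) (omega1 O).
Proof.
split; first exact: V_omega1_lattice.
split.
  apply/seteqP; split; last exact: Nideal_le (ltW (osucc_gt _)).
  by move=> v /Nideal_coord1 v1; exact: Nideal_omega1.
move=> g NgE; rewrite leNgt; apply/negP => gw.
have ar : index_range (osucc g).
  apply/andP; split; last exact: osucc_lt_omega1.
  by have := ozero_le g; rewrite le_eqVlt => /predU1P[<- //|/osucc_lt/ltW].
have [v vf] : inN A (osucc g) (single (osucc g) 0 (graft [::] (ones R A (osucc g)))).
  by apply: inN_single => //; [exact: node_nil|exact: S_ones].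
rewrite NgE graft_nil in vf * => Ng.
have [i Ii vi] : exists2 i, I_ A (osucc g) i & coord2 v (osucc g) ([::] ++ i) = 0.
  apply: (Nideal_zero_point ar (osucc_gt g) Ng) => sr.
  exact: Nideal_node Ng (node_nil A _) sr (osucc_gt g).
move: vi; rewrite (coord2_single _ _ vf) eqxx /ones mem_set //.
by move=> /eqP; rewrite oner_eq0.
Qed.
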